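(* Let $(A,\Phi,C)$ be a Chern-Weil triple. Then for every $n>0$ the element $$\mathcal C_n=\sum_{\mathcal T\in \mathrm{C.E.T.}(2n)}\Phi(\mathcal M_{\mathcal T})$$ is a cocycle in $C^{2n}$.
   Context: Graded vector spaces are non-negatively graded over a field $\mathbf k\in\{\mathbb R,\mathbb C\}$; chain complexes have differentials of degree $1$; the Koszul sign rule is used when applying graded maps. A curved $A_\infty$-algebra is a graded vector space $A$ with linear maps $m_k:A^{\otimes k}\to A$ of degree $2-k$, $k=0,1,2,\dots$, satisfying for every $n\ge0$ $$\sum_{r+s+t=n}(-1)^{r+st}m_{r+t+1}(\mathbf 1^{\otimes r}\otimes m_s\otimes\mathbf 1^{\otimes t})=0.$$ The image of $1\in\mathbf k$ under $m_0$ is also denoted $m_0\in A_2$. A Chern-Weil triple $(A,\Phi,C)$ consists of a curved $A_\infty$-algebra $(A,\{m_k\}_{k\ge 0})$, a chain complex $(C,d)$ and a linear map $\Phi:A\to C$ of degree zero such that (i) $\Phi(m_1(x))=d(\Phi(x))$ for every $x\in A$ of even degree; (ii) $\sum_{\sigma\in\mathbf S_n}\Phi(m_n(x_{\sigma(1)},\dots,x_{\sigma(n)}))=0$ for every odd $n>1$ and all even-degree $x_1,\dots,x_n\in A$. For a rooted planar tree $\mathcal T$, edges are oriented away from the root, and the valency of a vertex is the number of edges going out of it; vertices of valency $0$ are called tails. $\mathcal M_{\mathcal T}\in A$ is obtained by assigning to each vertex of valency $k$ the operation $m_k$ and composing according to $\mathcal T$. Recursively: if $\mathcal T$ is a single vertex,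 $\mathcal M_{\mathcal T}=m_0$; if the root has valency $k\geq 1$ with subtrees $\mathcal T_1,\dots,\mathcal T_k$ in planar order, $\mathcal M_{\mathcal T}=m_k(\mathcal M_{\mathcal T_1},\dots,\mathcal M_{\mathcal T_k})$. The degree of $\mathcal T$ is the degree of $\mathcal M_{\mathcal T}$, which equals $1+$ the number of vertices of $\mathcal T$. A tree is completely even if all its vertices have even valency ($0$ counts as even). $\mathrm{C.E.T.}(n)$ is the (finite) set of completely even rooted planar trees of degree $n$. *)

(* Defs.v *)
From HB Require Import structures.
From mathcomp Require Import all_boot all_order all_algebra all_fingroup.
From mathcomp Require Import boolp classical_sets functions cardinality fsbigop reals.
From mathcomp Require Import complex.

Set Implicit Arguments.
Unset Strict Implicit.
Unset Printing Implicit Defensive.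

Import Order.TTheory GRing.Theory Num.Theory.
Local Open Scope classical_set_scope.
Local Open Scope ring_scope.

Variant ground_kind := GroundReal | GroundComplex.

Definition ground_field (R : realType) (g : ground_kind) : fieldType :=
  match g with
  | GroundReal => R
  | GroundComplex => R[i]
  end.

(* A graded vector space is the total space of an internal direct sum of
   subspaces [gpart i], i >= 0. *)
Record gradedSpace (K : fieldType) := GradedSpace {
  gsort :> lmodType K;
  gpart : nat -> gsort -> Prop;
  gpart0 : forall i, gpart i 0;
  gpartP : forall i (a : K) x y, gpart i x -> gpart i y -> gpart i (a *: x + y);
  gpart_span : forall x, exists n (c : nat -> gsort),
    (forall i, gpart i (c i)) /\ x = \sum_(i < n) c i;
  gpart_indep : forall n (c : nat -> gsort), (forall i, gpart i (c i)) ->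
    \sum_(i < n) c i = 0 -> forall i, (i < n)%N -> c i = 0
}.

(* Degrees range over int because operations may lower them; the parts of
   negative degree are zero. *)
Definition homog (K : fieldType) (V : gradedSpace K) (j : int) (x : V) : Prop :=
  match j with
  | Posz i => gpart i x
  | Negz _ => x = 0
  end.

Definition homogs (K : fieldType) (V : gradedSpace K) (e : seq nat)
    (x : seq V) : Prop :=
  size e = size x /\
  forall i, (i < size x)%N -> homog (nth 0%N e i)%:Z (nth 0 x i).

Definition even_degree (K : fieldType) (V : gradedSpace K) (x : V) : Prop :=
  exists2 i : nat, ~~ odd i & homog i%:Z x.

Record chainComplex (K : fieldType) := ChainComplex {
  cspace :> gradedSpace K;
  cdiff : {linear cspace -> cspace};
  cdiff_deg : forall j (x : cspace), homog j x -> homog (j + 1) (cdiff x);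
  cdiffK : forall x, cdiff (cdiff x) = 0
}.

(* The linear maps m_k on the tensor powers of A are encoded as multilinear
   maps, all packed into one function on finite sequences:
   m_k(x_1, ..., x_k) is [ainf_op [:: x_1; ...; x_k]], and m_0 is
   [ainf_op [::]].  In [ainf_rel] the second sign is the Koszul sign for moving
   m_s, of degree 2 - s, past the first r arguments. *)
Record curvedAinfty (K : fieldType) := CurvedAinfty {
  aspace :> gradedSpace K;
  ainf_op : seq aspace -> aspace;
  ainf_op_linear : forall (s1 s2 : seq aspace) (a : K) (x y : aspace),
    ainf_op (s1 ++ (a *: x + y) :: s2) =
      a *: ainf_op (s1 ++ x :: s2) + ainf_op (s1 ++ y :: s2);
  ainf_op_deg : forall (e : seq nat) (x : seq aspace), homogs e x ->
    homog ((sumn e)%:Z + (2 - (size x)%:Z)) (ainf_op x);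
  ainf_rel : forall (e : seq nat) (x : seq aspace), homogs e x ->
    let n := size x in
    \sum_(r < n.+1) \sum_(s < n.+1) \sum_(t < n.+1 | (r + s + t == n)%N)
      ((-1) ^+ (r + s * t) * (-1) ^ ((2 - s%:Z) * (sumn (take r e))%:Z)) *:
        ainf_op (take r x ++ ainf_op (take s (drop r x)) :: drop (r + s) x) = 0
}.

Record ChernWeil (K : fieldType) (A : curvedAinfty K) (C : chainComplex K)
    (Phi : {linear A -> C}) : Prop := {
  cw_deg : forall j (x : A), homog j x -> homog j (Phi x);
  cw_m1 : forall x : A, even_degree x -> Phi (ainf_op [:: x]) = cdiff C (Phi x);
  cw_sym : forall (n : nat) (x : 'I_n -> A), odd n -> (1 < n)%N ->
    (forall i, even_degree (x i)) ->
    \sum_(sigma : 'S_n) Phi (ainf_op [seq x (sigma i) | i : 'I_n]) = 0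
}.

(* Rooted planar trees; the valency of [Node ts] is [size ts]. *)
Inductive ptree := Node of seq ptree.

Fixpoint ptree_encode (T : ptree) : GenTree.tree unit :=
  let: Node ts := T in GenTree.Node 0 [seq ptree_encode t | t <- ts].

Fixpoint ptree_decode (T : GenTree.tree unit) : ptree :=
  match T with
  | GenTree.Leaf _ => Node [::]
  | GenTree.Node _ ts => Node [seq ptree_decode t | t <- ts]
  end.

Lemma ptree_encodeK : cancel ptree_encode ptree_decode.
Proof.
rewrite /cancel; fix IH 1; case=> ts /=; congr Node.
by elim: ts => //= t ts ->; rewrite IH.
Qed.

HB.instance Definition _ := Choice.copy ptree (can_type ptree_encodeK).

Fixpoint vertices (T : ptree) : nat :=
  let: Node ts := T in (sumn [seq vertices t | t <- ts]).+1.

Fixpoint completely_even (T : ptree) : bool :=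
  let: Node ts := T in ~~ odd (size ts) && all completely_even ts.

(* [treeM T] is homogeneous of this degree: see [treeM_homog]. *)
Definition tree_degree (T : ptree) : nat := (vertices T).+1.

Definition CET (n : nat) : set ptree :=
  [set T | completely_even T /\ tree_degree T = n].

Fixpoint treeM (K : fieldType) (A : curvedAinfty K) (T : ptree) : A :=
  let: Node ts := T in ainf_op [seq treeM A t | t <- ts].

Lemma ptree_nested_ind (P : ptree -> Prop) :
  (forall ts, (forall i, (i < size ts)%N -> P (nth (Node [::]) ts i)) ->
     P (Node ts)) ->
  forall T, P T.
Proof.
move=> HP; fix IH 1; case=> ts; apply: HP.
elim: ts => [|t ts IHts] i; first by move=> lti0; exfalso; move: lti0.
by case: i => [|i] lti; [apply: IH t | apply: IHts lti].
Qed.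

Lemma treeM_homog (K : fieldType) (A : curvedAinfty K) (T : ptree) :
  homog (tree_degree T)%:Z (treeM A T).
Proof.
elim/ptree_nested_ind: T => ts IH.
have Hts : homogs [seq tree_degree t | t <- ts] [seq treeM A t | t <- ts].
  split; first by rewrite !size_map.
  move=> i; rewrite size_map => Hi.
  by rewrite !(nth_map (Node [::])) //; apply: IH.
have := ainf_op_deg Hts; rewrite size_map /=.
suff -> : (sumn [seq tree_degree t | t <- ts])%:Z + (2 - (size ts)%:Z) =
          (tree_degree (Node ts))%:Z by [].
have -> : sumn [seq tree_degree t | t <- ts] =
          (sumn [seq vertices t | t <- ts] + size ts)%N.
  elim: ts {IH Hts} => //= t ts ->.
  by rewrite /tree_degree addSn addnS addnA.
by rewrite /tree_degree /= PoszD addrC [X in _ + X]addrC addrA subrK -PoszD.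
Qed.

(* Finiteness matters because the finitely supported sum in [chern_weil_element]
   is 0 by convention when its support is infinite. *)
Lemma finite_CET (n : nat) : finite_set (CET n).
Proof.
have seqfin (E : seq ptree) k : exists L : seq (seq ptree),
    forall s, size s = k -> {subset s <= E} -> s \in L.
  elim: k => [|k [L HL]].
    by exists [:: [::]] => s /size0nil ->; rewrite inE.
  exists [seq x :: s | x <- E, s <- L] => -[|x s] //= [szs] sE.
  apply/allpairsP; exists (x, s); split => //=.
    by apply: sE; rewrite inE eqxx.
  by apply: HL => // y ys; apply: sE; rewrite inE ys orbT.
have vfin k : exists L : seq ptree, forall T, (vertices T <= k)%N -> T \in L.
  elim: k => [|k [E HE]]; first by exists [::]; case.
  have [L HL] : exists L : seq (seq ptree),
      forall s, (size s <= k)%N -> {subset s <= E} -> s \in L.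
    elim: (k) => [|j [L HL]].
      have [L HL] := seqfin E 0%N.
      by exists L => s; rewrite leqn0 => /eqP; apply: HL.
    have [L' HL'] := seqfin E j.+1.
    exists (L ++ L') => s; rewrite leq_eqVlt mem_cat => /orP[/eqP sz|sz] sE.
      by rewrite HL' ?orbT.
    by rewrite HL.
  exists [seq Node s | s <- L] => -[ts] /=; rewrite ltnS => Hts.
  apply: map_f; apply: HL.
    apply: leq_trans Hts; elim: ts => //= -[us] ts IH.
    by rewrite -add1n leq_add.
  move=> t tts; apply: HE; apply: leq_trans Hts.
  elim: ts tts => //= u ts IH; rewrite inE => /orP[/eqP ->|/IH].
    exact: leq_addr.
  by move=> /leq_trans; apply; apply: leq_addl.
have [L HL] := vfin n.
apply: (@sub_finite_set _ _ [set` L]); last exact: finite_seq.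
by move=> T [_ dT] /=; apply: HL; rewrite -dT leqnSn.
Qed.

Definition chern_weil_element (K : fieldType) (A : curvedAinfty K)
    (C : chainComplex K) (Phi : {linear A -> C}) (n : nat) : C :=
  \sum_(T \in CET (2 * n)) Phi (treeM A T).

(* Main.v *)
Require Import Defs.
From mathcomp Require Import all_boot all_order all_algebra all_fingroup.
From mathcomp Require Import boolp classical_sets cardinality fsbigop reals.
From mathcomp Require Import complex zify.

Set Implicit Arguments.
Unset Strict Implicit.
Unset Printing Implicit Defensive.

Import GRing.Theory Num.Theory.
Local Open Scope ring_scope.

(** Let c be the sum of the elements M_T over all completely even trees T,
    graded by the number of vertices. Splitting off the root of a tree gives
      c = m_0 + m_2(c, c) + m_4(c, c, c, c) + ... ,
    and c has even degree. The proof concerns the complementary sum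
      B = m_1(c) + m_3(c, c, c) + m_5(c, c, c, c, c) + ... .

    Evaluate the A-infinity relation on k copies of c and add over all even k.
    All Koszul signs are trivial. In the terms with an inner operation m_s, s
    even, these inner operations add up to c, and the outer operations, which
    are then of odd arity r + t + 1, come with the sign (-1)^r; for a fixed odd
    arity the signs of the possible positions r add up to 1, so that these
    terms together give B. In the terms with s odd the inner operations add up
    to B, always with the sign -1. Hence
      B = sum over even k and all positions of m_k(c, ..., c, B, c, ..., c),
    whose right side expresses the component of B of weight w + 1 by components
    of weight at most w, because m_k(c, ..., B, ..., c) involves at least one
    vertex more than B does. So B = 0 by induction on the weight ([odd_forests_vanish]).

    Applying Phi to B = 0, the arities k > 1 disappear by the symmetrization
    axiom, as k! is invertible ([symmetrized_sum_vanish]), and what remains is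
    Phi(m_1(c)) = d(Phi(c)).

    Everything is expanded into words of trees: c is an infinite sum, and
    m_k(c, ..., c) is the sum of m_k(M_T1, ..., M_Tk) over the words T1 ... Tk
    of k completely even trees, weighted by the total number of vertices.
    The rearrangements above are then bijections between sets of words:
    cutting a word in two ([sum_deconcat]) and replacing a word of even length
    by the tree it spans ([sum_root_subtrees]). *)

(** * Words of completely even trees *)

Lemma reindex_seq (V : nmodType) (I J : eqType) (s : seq I) (t : seq J)
    (P : pred I) (Q : pred J) (h : I -> J) (g : J -> I) (F : J -> V) :
  uniq s -> uniq t ->
  {in s, forall i, P i -> [/\ h i \in t, Q (h i) & g (h i) = i]} ->
  {in t, forall j, Q j -> [/\ g j \in s, P (g j) & h (g j) = j]} ->
  \sum_(j <- t | Q j) F j = \sum_(i <- s | P i) F (h i).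
Proof.
move=> us ut hP gP; rewrite -big_filter -[RHS]big_filter.
rewrite -(big_map h predT F); apply: perm_big; apply: uniq_perm.
- exact: filter_uniq.
- rewrite map_inj_in_uniq ?filter_uniq // => i j.
  rewrite !mem_filter => /andP[Pi si] /andP[Pj sj] eqh.
  by have [_ _ <-] := hP _ si Pi; rewrite eqh; have [] := hP _ sj Pj.
move=> j; rewrite mem_filter; apply/andP/mapP.
  move=> [Qj tj]; have [sg Pg <-] := gP _ tj Qj.
  by exists (g j) => //; rewrite mem_filter Pg.
case=> i; rewrite mem_filter => /andP[Pi si] ->.
by have [] := hP _ si Pi.
Qed.

Definition forest_vertices (u : seq ptree) : nat :=
  sumn [seq vertices t | t <- u].

Lemma forest_vertices_cat (u v : seq ptree) :
  forest_vertices (u ++ v) = (forest_vertices u + forest_vertices v)%N.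
Proof. by rewrite /forest_vertices map_cat sumn_cat. Qed.

Lemma forest_vertices_Node (u v : seq ptree) :
  forest_vertices (Node u :: v) = (forest_vertices u + forest_vertices v).+1.
Proof. by []. Qed.

(** In particular there are finitely many words of a given weight. *)
Lemma size_le_forest_vertices (u : seq ptree) : (size u <= forest_vertices u)%N.
Proof.
elim: u => // -[ts] u IH; rewrite forest_vertices_Node /= ltnS.
by rewrite (leq_trans IH) ?leq_addl.
Qed.

Definition subtrees (T : ptree) : seq ptree := let: Node ts := T in ts.

(** A finite enumeration of words, so that sums over words are ordinary finite
    sums; the bound k only has to exceed the weights in use. *)
Definition ce_forests (k : nat) (W : seq (seq ptree)) : Prop :=
  uniq W /\
  forall u, (u \in W) = all completely_even u && (forest_vertices u <= k)%N.

Lemma CET_enum (n : nat) :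
  exists2 L : seq ptree, uniq L & CET n = [set` L]%classic.
Proof.
have /finite_seqP[L ->] := finite_CET n.
exists (undup L); rewrite ?undup_uniq //.
by apply/seteqP; split=> T; rewrite /= mem_undup.
Qed.

(** Finiteness is inherited from that of the sets of completely even trees: a
    word of even length consists of the root subtrees of such a tree, and a word
    of odd length does so after one more leaf is put in front. *)
Lemma ce_forests_exist (k : nat) : exists W, ce_forests k W.
Proof.
have [L HL] : exists L : seq ptree, forall T,
    completely_even T -> (vertices T <= k.+2)%N -> T \in L.
  have /finite_seqP[L HL] : finite_set (\bigcup_(i in `I_k.+4) CET i)%classic.
    by apply: bigcup_finite => [|i _]; [apply: finite_II | apply: finite_CET].
  exists L => T ceT vT.
  suff : [set` L]%classic T by [].
  by rewrite -HL; exists (tree_degree T).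
pose W := [seq subtrees T | T <- L] ++ [seq behead (subtrees T) | T <- L].
exists [seq u <- undup W | all completely_even u && (forest_vertices u <= k)%N].
split=> [|u]; first by rewrite filter_uniq ?undup_uniq.
rewrite mem_filter mem_undup mem_cat; apply: andb_idr => /andP[ceu vu].
case odd_u: (odd (size u)); apply/orP; [right | left].
  apply/mapP; exists (Node (Node [::] :: u)) => //; apply: HL => /=.
    by rewrite odd_u.
  by rewrite !ltnS.
apply/mapP; exists (Node u) => //; apply: HL => /=; first by rewrite odd_u.
by rewrite ltnS ltnW.
Qed.

(** A word with a place to cut it is the same as a pair of words. *)
Lemma sum_deconcat (V : nmodType) (k : nat) (W : seq (seq ptree))
    (P : pred (seq ptree)) (F : seq ptree -> seq ptree -> V) :
  ce_forests k W -> (forall u, P u -> (forest_vertices u <= k)%N) ->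
  \sum_(u <- W | P u) \sum_(r < (size u).+1) F (take r u) (drop r u) =
  \sum_(a <- W) \sum_(b <- W | P (a ++ b)) F a b.
Proof.
move=> [uW inW] Pk.
under [RHS]eq_bigr do rewrite big_mkcond.
rewrite -(big_allpairs (F := fun p => if P (p.1 ++ p.2) then F p.1 p.2 else 0)).
rewrite -[RHS]big_mkcond /=.
under eq_bigr do rewrite -(big_mkord xpredT (fun r => F (take r _) (drop r _))).
rewrite -big_filter.
rewrite -(big_allpairs_dep (h := fun (u : seq ptree) (r : nat) => (u, r))
  (F := fun ur : seq ptree * nat => F (take ur.2 ur.1) (drop ur.2 ur.1))).
symmetry.
apply: (reindex_seq (P := predT)
  (h := fun ur : seq ptree * nat => (take ur.2 ur.1, drop ur.2 ur.1))
  (g := fun ab : seq ptree * seq ptree => (ab.1 ++ ab.2, size ab.1))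
  (fun ab => F ab.1 ab.2)).
- by apply: allpairs_uniq_dep => [|u _|[u r] [u' r'] _ _ [-> ->]] //;
    rewrite ?filter_uniq ?iota_uniq.
- by apply: allpairs_uniq => // -[u r] [u' r'] _ _ [-> ->].
- move=> _ /allpairsPdep[u [r [+ + ->]]] /=.
  rewrite mem_filter mem_index_iota ltnS inW => /and3P[Pu ceu vu] ru _ /=.
  rewrite cat_take_drop size_takel //; split=> //.
  move: ceu vu; rewrite -[in all _ _](cat_take_drop r u).
  rewrite -[in forest_vertices _](cat_take_drop r u).
  rewrite all_cat forest_vertices_cat => /andP[ce1 ce2] vu.
  apply/allpairsP; exists (take r u, drop r u).
  by rewrite /= !inW ce1 ce2 !(leq_trans _ vu) ?leq_addl ?leq_addr.
- move=> _ /allpairsP[[a b] [aW bW ->]] Pab; split=> //.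
    apply/allpairsPdep; exists (a ++ b), (size a).
    rewrite mem_filter Pab mem_index_iota ltnS size_cat.
    move: aW bW; rewrite !inW all_cat (Pk _ Pab) => /andP[-> _] /andP[-> _].
    by split; rewrite //= leq_addr.
  by rewrite /= take_size_cat // drop_size_cat.
Qed.

(** A nonempty word is its first tree followed by a word, and completely even
    trees are the same as words of even length: this is the identity
    c = m_0 + m_2(c, c) + ... at the level of words. *)
Lemma sum_root_subtrees (V : nmodType) (k : nat) (W : seq (seq ptree))
    (P : pred (seq ptree)) (F : seq ptree -> V) :
  ce_forests k W -> (forall u, P u -> (forest_vertices u <= k)%N) ->
  \sum_(c <- W | (c != [::]) && P c) F c =
  \sum_(v <- W | ~~ odd (size v)) \sum_(b <- W | P (Node v :: b))
    F (Node v :: b).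
Proof.
move=> [uW inW] Pk.
under [RHS]eq_bigr do rewrite big_mkcond.
rewrite big_mkcond [RHS]big_mkcond.
under [RHS]eq_bigr do rewrite -[X in if _ then X else _]big_mkcond.
rewrite -big_mkcond -[RHS]big_mkcond /=.
under [RHS]eq_bigr do rewrite big_mkcond.
rewrite -big_filter -[RHS]big_filter.
rewrite -(big_allpairs (F := fun p => if P (Node p.1 :: p.2)
  then F (Node p.1 :: p.2) else 0)) -[RHS]big_mkcond [LHS]big_filter /=.
apply: (reindex_seq (Q := fun c => (c != [::]) && P c)
  (h := fun vb : seq ptree * seq ptree => Node vb.1 :: vb.2)
  (g := fun c => (subtrees (head (Node [::]) c), behead c))).
- apply: allpairs_uniq; rewrite ?filter_uniq //.
  by move=> [v b] [v' b'] _ _ [-> ->].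
- exact: uW.
- move=> _ /allpairsP[[v b] [/= + + ->]] /= PN.
  rewrite mem_filter !inW => /andP[ev /andP[cev _]] /andP[ceb _].
  by rewrite /= PN (Pk _ PN) ev cev ceb.
- move=> [|[v] b] //= /[swap] PN; rewrite inW /=.
  move=> /andP[/andP[/andP[ev cev] ceb]].
  rewrite forest_vertices_Node => vk; split=> //.
  apply/allpairsP; exists (v, b).
  rewrite mem_filter !inW ev cev ceb.
  by rewrite !(leq_trans _ (ltnW vk)) ?leq_addl ?leq_addr.
Qed.

(** * The quadratic relation on trees *)

Lemma ainf_op_sum (K : fieldType) (A : curvedAinfty K) (s1 s2 : seq A)
    (I : Type) (r : seq I) (P : pred I) (x : I -> A) :
  ainf_op (s1 ++ (\sum_(i <- r | P i) x i) :: s2) =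
  \sum_(i <- r | P i) ainf_op (s1 ++ x i :: s2).
Proof.
have opD y z : ainf_op (s1 ++ (y + z) :: s2) =
    ainf_op (s1 ++ y :: s2) + ainf_op (s1 ++ z :: s2).
  by have := ainf_op_linear s1 s2 1 y z; rewrite !scale1r.
apply: (big_morph (fun y => ainf_op (s1 ++ y :: s2)) opD).
by apply: (@addrI _ (ainf_op (s1 ++ 0 :: s2))); rewrite -opD !addr0.
Qed.

(** Each of the evenly many root subtrees contributes an odd number of vertices,
    and the root one more. *)
Lemma odd_vertices (T : ptree) : completely_even T -> odd (vertices T).
Proof.
elim/ptree_nested_ind: T => ts IH /= /andP[ets cets].
suff -> : odd (sumn [seq vertices t | t <- ts]) = odd (size ts) by [].
elim: ts IH cets {ets} => //= t ts IHts IH /andP[cet cets].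
by rewrite oddD (IH 0%N) // IHts // => i lti; apply: (IH i.+1).
Qed.

Lemma odd_forest_vertices (u : seq ptree) :
  all completely_even u -> odd (forest_vertices u) = odd (size u).
Proof.
elim: u => //= t u IH /andP[cet ceu].
by rewrite /forest_vertices /= oddD odd_vertices // IH.
Qed.

Lemma even_degree_treeM (K : fieldType) (A : curvedAinfty K) (T : ptree) :
  completely_even T -> even_degree (treeM A T).
Proof.
case: T => ts /andP[ets cets]; exists (tree_degree (Node ts)).
  rewrite /tree_degree /= negbK.
  by have /= -> := odd_forest_vertices cets.
exact: treeM_homog.
Qed.

Definition graft (a v b : seq ptree) : ptree := Node (a ++ Node v :: b).

(** The terms of the A-infinity relation on words of even length, each with the
    sign it has there. *)
Definition signed_graft (K : fieldType) (A : curvedAinfty K)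
    (a v b : seq ptree) : A :=
  (-1) ^+ (if odd (size v) then 1%N else size a) *: treeM A (graft a v b).

(** The relation of total arity n, for n even, on elements of even degree: the
    Koszul sign is trivial, and r + s t with r + s + t even is odd when s is
    odd, and has the parity of r when s is even. *)
Lemma tree_relation (K : fieldType) (A : curvedAinfty K) (u : seq ptree) :
  all completely_even u -> ~~ odd (size u) ->
  \sum_(r < (size u).+1) \sum_(s < (size (drop r u)).+1)
    signed_graft A (take r u) (take s (drop r u)) (drop s (drop r u)) = 0.
Proof.
move=> ceu eu.
have Hu : homogs [seq tree_degree t | t <- u] [seq treeM A t | t <- u].
  split=> [|i]; first by rewrite !size_map.
  rewrite size_map => lti; rewrite !(nth_map (Node [::])) //.
  exact: treeM_homog.
have := ainf_rel Hu; rewrite /= size_map => rel; rewrite -[RHS]rel.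
apply: eq_bigr => r _; rewrite size_drop.
rewrite (big_ord_widen (size u).+1 (fun s => signed_graft A (take r u)
  (take s (drop r u)) (drop s (drop r u)))) ?ltnS ?leq_subr //.
rewrite big_mkcond; apply: eq_bigr => s _.
rewrite [(s < _)%N]ltnS; have [les|lts] := leqP s (size u - r); last first.
  by rewrite big_pred0 // => t; apply/eqP; lia.
have rs_n : (r + s <= size u)%N by move: (ltn_ord r); lia.
rewrite (eq_bigl (fun t : 'I__ => (t : nat) == (size u - (r + s))%N));
  last by move=> t; apply/eqP/eqP; lia.
rewrite (big_ord1_eq _ (fun t => ((-1) ^+ (r + s * t) *
  (-1) ^ ((2 - s%:Z) * (sumn (take r [seq tree_degree t | t <- u]))%:Z)) *: _)).
rewrite ltnS leq_subr /signed_graft !size_takel ?size_drop -1?ltnS //.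
have even_deg : ~~ odd (sumn (take r [seq tree_degree t | t <- u])).
  rewrite -map_take; have := ceu; rewrite -[u in all _ u](cat_take_drop r).
  rewrite all_cat => /andP[+ _]; elim: (take r u) => //= t v IH /andP[cet cev].
  by rewrite /tree_degree oddD /= odd_vertices //= IH.
rewrite [X in _ ^ X]mulrC -exprz_exp -exprnP -(signr_odd _ (sumn _))
  (negbTE even_deg).
rewrite expr0 exp1rz.
rewrite mulr1 -map_take -!map_drop -map_take /graft /= map_cat /=.
rewrite drop_drop addnC.
congr (_ *: _).
rewrite -signr_odd -[RHS]signr_odd.
congr (_ ^+ (nat_of_bool _)).
rewrite oddD oddM oddB // oddD (negbTE eu).
by case: ifP; case: (odd r).
Qed.

Lemma ainf_op0 (K : fieldType) (A : curvedAinfty K) (s1 s2 : seq A) :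
  ainf_op (s1 ++ 0 :: s2) = 0.
Proof.
have := ainf_op_sum s1 s2 [::] xpredT (fun i : unit => 0).
by rewrite !big_nil.
Qed.

(** * Vanishing of the sums over words of odd length *)

Lemma sum_signs (R : pzRingType) (n : nat) :
  \sum_(r < n) (-1) ^+ r = (odd n)%:R :> R.
Proof.
elim: n => [|n IH]; first by rewrite big_ord0.
rewrite big_ord_recr /= IH -signr_odd.
by case: (odd n); rewrite /= ?add0r // expr1 subrr.
Qed.

(** The identity (-1)^0 + ... + (-1)^(n-1) = 1 for odd n, written as a sum over
    all cuts of u, in which a cut at the end, having no tree to its right to
    mark, counts as zero. *)
Lemma sum_marked (K : fieldType) (A : curvedAinfty K) (u : seq ptree) :
  odd (size u) ->
  \sum_(r < (size u).+1) (if drop r u != [::]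
    then (-1) ^+ size (take r u) *: treeM A (Node (take r u ++ drop r u))
    else 0) = treeM A (Node u).
Proof.
move=> ou; under eq_bigr do rewrite cat_take_drop.
move: (treeM A (Node u)) => x; rewrite big_ord_recr /= drop_size eqxx addr0.
transitivity ((odd (size u))%:R *: x); last by rewrite ou scale1r.
rewrite -sum_signs scaler_suml; apply: eq_bigr => r _.
by rewrite size_takel 1?ltnW // -size_eq0 size_drop subn_eq0 leqNgt ltn_ord.
Qed.

(** The components of B vanish, by induction on the weight: the tree relations
    of weight N sum to the component of weight N + 1, plus terms which contain a
    component of weight at most N. *)
Lemma odd_forests_vanish (K : fieldType) (A : curvedAinfty K) (k : nat)
    (W : seq (seq ptree)) (w : nat) :
  ce_forests k W -> (w <= k)%N ->
  \sum_(u <- W | odd (size u) && (forest_vertices u == w)) treeM A (Node u) = 0.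
Proof.
move=> HW; have [uW inW] := HW; elim/ltn_ind: w => -[|N] IH wk.
  apply: big1 => -[//|t u] /andP[_ /eqP uw].
  by have := size_le_forest_vertices (t :: u); rewrite uw.
pose P u := ~~ odd (size u) && (forest_vertices u == N).
pose Q u := odd (size u) && (forest_vertices u == N.+1).
have Pk u : P u -> (forest_vertices u <= k)%N.
  by move=> /andP[_ /eqP->]; apply: ltnW.
have Qk u : Q u -> (forest_vertices u <= k)%N by move=> /andP[_ /eqP->].
(* Each word of even length and weight N, with an inner operation chosen, is
   a word cut in three. *)
have rel : \sum_(a <- W) \sum_(v <- W) \sum_(b <- W | P (a ++ v ++ b))
    signed_graft A a v b = 0.
  transitivity (\sum_(a <- W) \sum_(c <- W | P (a ++ c))
      \sum_(s < (size c).+1) signed_graft A a (take s c) (drop s c)).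
    apply: eq_bigr => a _; rewrite (sum_deconcat _ HW) // => c Pac.
    by rewrite (leq_trans _ (Pk _ Pac)) // forest_vertices_cat leq_addl.
  rewrite -(sum_deconcat (fun a c => \sum_(s < (size c).+1)
    signed_graft A a (take s c) (drop s c)) HW) //.
  apply: big1_seq => u /andP[/andP[eu _]]; rewrite inW => /andP[ceu _].
  exact: tree_relation.
(* For fixed a and b, the words v of odd length that complete them, if any,
   are all the words of odd length of one weight, at most N. *)
have odd_part : \sum_(a <- W) \sum_(v <- W | odd (size v))
    \sum_(b <- W | P (a ++ v ++ b)) signed_graft A a v b = 0.
  apply: big1 => a _; rewrite (exchange_big_dep xpredT) //=; apply: big1 => b _.
  have [abN|Nab] := leqP (forest_vertices a + forest_vertices b) N; last first.
    rewrite big_pred0 // => v; rewrite /P !forest_vertices_cat.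
    by apply/negP => /and3P[_ _ /eqP]; lia.
  case oab : (odd (size a + size b)); last first.
    rewrite big_pred0 // => v; rewrite /P !size_cat !oddD.
    by move: oab; rewrite oddD; case: (odd (size v)); case: (odd (size a));
    case: (odd (size b)).
  rewrite (eq_bigl (fun v => odd (size v) &&
    (forest_vertices v == N - (forest_vertices a + forest_vertices b))%N)).
    under eq_bigr => v /andP[ov _] do
      rewrite /signed_graft ov /graft /= map_cat /=
        -[ainf_op [seq _ | _ <- v]]/(treeM A (Node v)).
    rewrite -scaler_sumr -ainf_op_sum IH ?ainf_op0 ?scaler0 //; lia.
  move=> v; rewrite /P !size_cat !forest_vertices_cat !oddD.
  move: oab; rewrite oddD; case: (odd (size v)) => //=.
  by case: (odd (size a)); case: (odd (size b)) => //= _; lia.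
have even_part : \sum_(a <- W) \sum_(v <- W | ~~ odd (size v))
    \sum_(b <- W | P (a ++ v ++ b)) signed_graft A a v b = 0.
  move: rel; under eq_bigr do rewrite (bigID (fun v => odd (size v))) /=.
  by rewrite big_split odd_part /= add0r.
(* When v has even length, a ++ Node v :: b is a word of odd length and weight N + 1
   with a marked tree; the marks are summed with alternating signs. *)
rewrite -[RHS]even_part.
under eq_bigr => u /andP[ou _] do rewrite -(sum_marked A ou).
rewrite (sum_deconcat (fun a c => if c != [::]
  then (-1) ^+ size a *: treeM A (Node (a ++ c)) else 0) HW) //.
apply: eq_bigr => a _; rewrite -big_mkcondl.
rewrite (sum_root_subtrees _ HW) => [|c Qac]; last first.
  by rewrite (leq_trans _ (Qk _ Qac)) // forest_vertices_cat leq_addl.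
apply: eq_bigr => v ev; apply: eq_big => [b|b _].
  rewrite /P /Q !size_cat !forest_vertices_cat forest_vertices_Node !oddD /=.
  rewrite (negbTE ev) addnS eqSS.
  by case: (odd (size a)); case: (odd (size b)).
by rewrite /signed_graft (negbTE ev).
Qed.

(** * The cocycle property *)

Definition permute (T : Type) (x0 : T) (n : nat) (sigma : 'S_n) (u : seq T) :
  seq T := [seq nth x0 u (sigma i) | i : 'I_n].

Lemma perm_permute (T : eqType) (x0 : T) (n : nat) (sigma : 'S_n) (u : seq T) :
  size u = n -> perm_eq (permute x0 sigma u) u.
Proof.
move=> /eqP size_u; apply/(tuple_permP (t := Tuple size_u)).
by exists sigma; apply: eq_codom => i; rewrite (tnth_nth x0).
Qed.

Lemma permuteM (T : Type) (x0 : T) (n : nat) (s t : 'S_n) (u : seq T) :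
  permute x0 s (permute x0 t u) = permute x0 (s * t)%g u.
Proof.
apply: eq_codom => i; rewrite permM.
by rewrite /permute (nth_map (s i)) ?size_enum_ord // nth_ord_enum.
Qed.

Lemma permute1 (T : Type) (x0 : T) (n : nat) (u : seq T) :
  size u = n -> permute x0 (1 : 'S_n)%g u = u.
Proof.
move=> size_u; apply: (@eq_from_nth _ x0) => [|i].
  by rewrite size_map size_enum_ord size_u.
rewrite size_map size_enum_ord => lti.
rewrite /permute (nth_map (Ordinal lti)) ?size_enum_ord //.
by rewrite perm1 nth_enum_ord.
Qed.

(** The words in question are stable under permutation of their letters, so
    n! times the sum is a sum of symmetrizations, each of which is zero. *)
Lemma symmetrized_sum_vanish (K : fieldType) (A : curvedAinfty K)
    (C : chainComplex K) (Phi : {linear A -> C}) (k : nat)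
    (W : seq (seq ptree)) (n w : nat) :
  [pchar K]%R =i pred0 -> ChernWeil Phi -> ce_forests k W ->
  odd n -> (1 < n)%N ->
  \sum_(u <- W | (size u == n) && (forest_vertices u == w))
    Phi (treeM A (Node u)) = 0.
Proof.
move=> char0 HPhi [uW inW] on n_gt1.
set P := fun u => (size u == n) && (forest_vertices u == w).
set S := LHS.
have sum_permute (sigma : 'S_n) :
    S = \sum_(u <- W | P u)
          Phi (treeM A (Node (permute (Node [::]) sigma u))).
  have permP (t : 'S_n) : {in W, forall u, P u ->
      permute (Node [::]) t u \in W /\ P (permute (Node [::]) t u)}.
    move=> u; rewrite inW => /andP[ceu vu] /andP[/eqP size_u /eqP wu].
    have pu := perm_permute (Node [::]) t size_u.
    have vE : forest_vertices (permute (Node [::]) t u) = w.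
      by rewrite -wu; apply: perm_sumn; apply: perm_map.
    rewrite inW /P (perm_all _ pu) ceu vE (perm_size pu) size_u !eqxx.
    by rewrite -wu vu.
  apply: (reindex_seq (g := permute (Node [::]) sigma^-1)) => // u Wu Pu.
    have [? ?] := permP sigma u Wu Pu; have /andP[/eqP size_u _] := Pu.
    by split; rewrite // permuteM mulVg permute1.
  have [? ?] := permP sigma^-1%g u Wu Pu; have /andP[/eqP size_u _] := Pu.
  by split; rewrite // permuteM mulgV permute1.
have : \sum_(sigma : 'S_n) S = 0.
  rewrite (eq_bigr _ (fun sigma _ => sum_permute sigma)) exchange_big /=.
  apply: big1_seq => u /andP[/andP[/eqP size_u _]]; rewrite inW => /andP[ceu _].
  rewrite -[RHS](cw_sym HPhi (x := fun i => treeM A (nth (Node [::]) u i))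
    on n_gt1) => [|i].
    by apply: eq_bigr => sigma _; rewrite /= /permute -map_comp.
  by apply: even_degree_treeM; apply: (all_nthP _ ceu); rewrite size_u.
have /pcharf0P natf0 := char0.
rewrite sumr_const -scaler_nat => /eqP; rewrite scaler_eq0 card_Sn natf0.
by rewrite eqn0Ngt fact_gt0 /= => /eqP.
Qed.

(** The trees of degree 2n, seen as words of length one, have weight 2n - 1. The
    sum over all words of odd length and this weight is zero, and Phi
    kills its part of each length above one, hence also the part of length one,
    which Phi maps to the differential of the characteristic element. *)
Theorem chern_weil_cocycle (K : fieldType) (A : curvedAinfty K)
    (C : chainComplex K) (Phi : {linear A -> C}) (n : nat) :
  [pchar K]%R =i pred0 -> ChernWeil Phi -> (0 < n)%N ->
  cdiff C (chern_weil_element Phi n) = 0.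
Proof.
move=> char0 HPhi n_gt0.
pose w := (2 * n).-1.
have [W HW] := ce_forests_exist w; have [uW inW] := HW.
pose sumPhi m := \sum_(u <- W | (size u == m) && (forest_vertices u == w))
  Phi (treeM A (Node u)).
have dE : cdiff C (chern_weil_element Phi n) = sumPhi 1%N.
  have [L uL HL] := CET_enum (2 * n).
  rewrite /chern_weil_element HL -fsbig_seq // linear_sum /sumPhi /=; symmetry.
  have inCET T : (T \in L) = completely_even T && (vertices T == w).
    have LE : T \in L <-> CET (2 * n) T by rewrite HL.
    apply/idP/andP => [/LE[ceT] | [ceT /eqP vT]].
      by rewrite /tree_degree /w ceT => <- /=.
    by apply/LE; split; rewrite // /tree_degree vT prednK // muln_gt0.
  rewrite (reindex_seq (s := L) (P := xpredT)
    (h := fun T => [:: T]) (g := head (Node [::]))) //.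
  - rewrite big_seq [RHS]big_seq; apply: eq_bigr => T.
    rewrite inCET => /andP[ceT _].
    by rewrite -(cw_m1 HPhi) //; apply: even_degree_treeM.
  - move=> T; rewrite inCET => /andP[ceT /eqP vT] _.
    by rewrite inW /forest_vertices /= ceT addn0 vT leqnn eqxx.
  - move=> [|T [|? ?]] //; rewrite inW /forest_vertices /= addn0 !andbT.
    by move=> /andP[ceT _] vT; rewrite inCET ceT vT.
have : Phi (\sum_(u <- W | odd (size u) && (forest_vertices u == w))
  treeM A (Node u)) = 0 by rewrite (odd_forests_vanish _ HW) ?linear0.
rewrite linear_sum.
rewrite (partition_big (fun u => inord (size u) : 'I_w.+1) xpredT) //=.
have sizeE (m : 'I_w.+1) : \sum_(u <- W |
    odd (size u) && (forest_vertices u == w) && (inord (size u) == m))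
      Phi (treeM A (Node u)) = if odd m then sumPhi m else 0.
  transitivity (\sum_(u <- W | odd m && ((size u == m) &&
      (forest_vertices u == w))) Phi (treeM A (Node u))); last first.
    by case: (odd m); rewrite // big_pred0_eq.
  apply: eq_bigl => u.
  case vu: (forest_vertices u == w); rewrite ?andbF // !andbT.
  have size_u : (size u < w.+1)%N.
    by rewrite ltnS -(eqP vu) size_le_forest_vertices.
  rewrite -(inj_eq val_inj) /= inordK //.
  by apply/andP/andP => -[+ /eqP sE]; rewrite sE; split.
under eq_bigr do rewrite sizeE.
have lt1w : (1 < w.+1)%N by rewrite /w; lia.
rewrite (bigD1 (Ordinal lt1w)) //= -dE big1 ?addr0 // => m m_neq1.
case: ifP => // om; apply: (symmetrized_sum_vanish _ char0 HPhi HW om).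
move: m_neq1 om; rewrite -(inj_eq val_inj) /=.
by case: (nat_of_ord m) => [|[|]].
Qed.

Theorem theorem4p3 (R : realType) (g : ground_kind)
    (A : curvedAinfty (ground_field R g)) (C : chainComplex (ground_field R g))
    (Phi : {linear A -> C}) (HPhi : ChernWeil Phi) (n : nat) (n_gt0 : (0 < n)%N) :
  homog (2 * n)%N%:Z (chern_weil_element Phi n) /\
  cdiff C (chern_weil_element Phi n) = 0.
Proof.
split; last first.
  apply: (chern_weil_cocycle _ HPhi n_gt0).
  by case: g {A C Phi HPhi} => /=; apply: pchar_num.
have [L uL HL] := CET_enum (2 * n).
rewrite /chern_weil_element HL -fsbig_seq // big_seq.
apply: big_ind => [|x y hx hy|T].
- exact: gpart0.
- by have := gpartP 1 hx hy; rewrite scale1r.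
move=> TL; have [_ <-] : CET (2 * n) T by rewrite HL.
by apply: (cw_deg HPhi); apply: treeM_homog.
Qed.
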